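(* If a finite algebra $\mathfrak{A}$ has almost minimal spectrum, then $\{\mathfrak{A}\}$ is a direct factor set.
   Context: A finite algebra $\mathfrak{A}$ has almost minimal spectrum iff every subalgebra of every finite power $\mathfrak{A}^n$ has cardinality a power of $|A|$. A subdirect product $\mathfrak{B}$ of $\mathfrak{A}_1,\dots,\mathfrak{A}_n$ is irreducible iff for every proper subset of the coordinate projections, the intersection of their kernels on $\mathfrak{B}$ is strictly larger than the identity congruence. A set $\mathcal{A}$ of finite algebras is a direct factor set iff whenever $\mathfrak{B}$ is an irreducible subdirect product of algebras $\mathfrak{A}_1,\dots,\mathfrak{A}_n$ from $\mathcal{A}$, then $\mathfrak{B}=\mathfrak{A}_1\times\dots\times\mathfrak{A}_n$. *)

(* Defs.v *)
From HB Require Import structures.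
From mathcomp Require Import all_boot.

Set Implicit Arguments.
Unset Strict Implicit.
Unset Printing Implicit Defensive.

(* Finitary signatures; the collection of operation symbols may be infinite. *)
Record signature := Signature {
  symbol : Type;
  arity : symbol -> nat
}.

Record finAlgebra (S : signature) := FinAlgebra {
  carrier :> finType;
  interp : forall f : symbol S, {ffun 'I_(arity f) -> carrier} -> carrier;
  carrier_gt0 : 0 < #|carrier|
}.

Arguments interp {S} A f x : rename.

Section Product.

Variables (S : signature) (n : nat) (A : 'I_n -> finAlgebra S).

Definition prod_carrier : finType := {dffun forall i : 'I_n, A i}.

Definition prod_interp (f : symbol S)
    (x : {ffun 'I_(arity f) -> prod_carrier}) : prod_carrier :=
  [ffun i : 'I_n => interp (A i) f [ffun j => (x j : {dffun forall i, A i}) i]].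

Lemma prod_carrier_gt0 : 0 < #|prod_carrier|.
Proof.
rewrite card_dep_ffun foldrE big_map.
by elim/big_ind: _ => // [x y ? ?|i _]; rewrite ?muln_gt0 ?carrier_gt0 //; apply/andP.
Qed.

Definition prod_alg : finAlgebra S := FinAlgebra prod_interp prod_carrier_gt0.

Definition proj (i : 'I_n) (x : prod_alg) : A i :=
  (x : {dffun forall i, A i}) i.

End Product.

Definition power_alg (S : signature) (A : finAlgebra S) (n : nat) :
  finAlgebra S := prod_alg (fun _ : 'I_n => A).

(* Subalgebras are identified with their universes and, like all algebras,
   are nonempty. *)
Definition subalgebra (S : signature) (A : finAlgebra S) (B : {set A}) : Prop :=
  B != set0 /\
  forall (f : symbol S) (x : {ffun 'I_(arity f) -> A}),
    (forall j, x j \in B) -> interp A f x \in B.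

Definition almost_minimal_spectrum (S : signature) (A : finAlgebra S) : Prop :=
  forall (n : nat) (B : {set power_alg A n}),
    subalgebra B -> exists k : nat, #|B| = #|A| ^ k.

Section Subdirect.

Variables (S : signature) (n : nat) (A : 'I_n -> finAlgebra S).
Variable B : {set prod_alg A}.

Definition subdirect_product : Prop :=
  subalgebra B /\
  forall (i : 'I_n) (a : A i), exists2 x, x \in B & proj i x = a.

(* Congruences of B are represented by their graphs, as subsets of B x B. *)
Definition id_cong : {set prod_alg A * prod_alg A} :=
  [set p in setX B B | p.1 == p.2].

Definition proj_ker (i : 'I_n) : {set prod_alg A * prod_alg A} :=
  [set p in setX B B | proj i p.1 == proj i p.2].

(* The leading setX B B makes the intersection over J = set0 the total
   congruence of B. *)
Definition cap_proj_ker (J : {set 'I_n}) : {set prod_alg A * prod_alg A} :=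
  setX B B :&: \bigcap_(i in J) proj_ker i.

(* Projections are counted with their indices: equal projections on B at
   distinct coordinates are distinct members of the family. *)
Definition irreducible_subdirect : Prop :=
  subdirect_product /\
  forall J : {set 'I_n}, J \proper [set: 'I_n] ->
    id_cong \proper cap_proj_ker J.

End Subdirect.

Definition direct_factor_set (S : signature) (K : finAlgebra S -> Prop) : Prop :=
  forall (n : nat) (A : 'I_n -> finAlgebra S), (forall i, K (A i)) ->
  forall B : {set prod_alg A},
    irreducible_subdirect B -> B = [set: prod_alg A].

(* Main.v *)
Require Import Defs.
From Stdlib Require Import FunctionalExtensionality.
From mathcomp Require Import all_boot.

Set Implicit Arguments.
Unset Strict Implicit.
Unset Printing Implicit Defensive.

(** Let B <= A^n be irreducible and let B' be its projection forgetting the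
    coordinate i.  By irreducibility |B'| < |B|; as both cardinalities are
    powers of |A|, this gives |A| |B'| <= |B|.  But B embeds into A x B', so
    this embedding is onto: the i-th coordinate of an element of B can be
    changed arbitrarily without leaving B.  As i is arbitrary, B = A^n. *)

Section ForgetCoordinate.

Variables (S : signature) (A : finAlgebra S) (n : nat) (i : 'I_n.+1).

Definition forget (x : power_alg A n.+1) : power_alg A n :=
  [ffun j : 'I_n => proj (lift i j) x].

Lemma forgetP (x y : power_alg A n.+1) :
  forget x = forget y <-> (forall j, j != i -> proj j x = proj j y).
Proof.
split=> [exy j|exy].
- rewrite eq_sym => /unlift_some[k -> _].
  by have /ffunP/(_ k) := exy; rewrite !ffunE.
- by apply/ffunP=> k; rewrite !ffunE exy // eq_sym neq_lift.
Qed.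

Lemma proj_forget_inj : injective (fun x => (proj i x, forget x)).
Proof.
move=> x y [exi /forgetP exy]; apply/ffunP=> j.
by have [->|/exy] := eqVneq j i.
Qed.

Lemma subalgebra_forget (B : {set power_alg A n.+1}) :
  subalgebra B -> subalgebra (forget @: B).
Proof.
move=> [B0 clB]; split.
  have /set0Pn[x xB] := B0.
  by apply/set0Pn; exists (forget x); apply: imset_f.
move=> f x xB.
have preB j : exists y, (y \in B) && (x j == forget y).
  by have /imsetP[y yB ->] := xB j; exists y; rewrite yB eqxx.
pose y := [ffun j => xchoose (preB j)].
have yB j : y j \in B by rewrite ffunE; case/andP: (xchooseP (preB j)).
have yx j : x j = forget (y j).
  by rewrite ffunE; case/andP: (xchooseP (preB j)) => _ /eqP.
(* The body of [y] is dropped, so that the chosen preimages stay opaque to [ffunE] below. *)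
move: y yB yx => y yB yx.
apply/imsetP; exists (interp (power_alg A n.+1) f y); first exact: clB.
apply/ffunP=> k; rewrite !ffunE /proj /= !ffunE; congr (interp A f _).
by apply/ffunP=> j; rewrite ffunE yx !ffunE.
Qed.

(** Irreducibility, applied to all projections except the [i]-th, yields two distinct elements of
    [B] that agree off [i]; [forget] identifies them. *)
Lemma forget_noninjective (B : {set power_alg A n.+1}) :
  irreducible_subdirect B -> #|forget @: B| < #|B|.
Proof.
move=> [_ irrB]; rewrite ltn_neqAle leq_imset_card andbT.
apply/imset_injP => inj_forget.
have prJ : [set~ i] \proper [set: 'I_n.+1].
  by rewrite properT; apply/eqP=> /setP/(_ i); rewrite !inE eqxx.
have /properP[_ [[x y]]] := irrB _ prJ.
rewrite !inE /= => /andP[/andP[xB yB] /bigcapP kxy]; rewrite xB yB /=.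
case/eqP; apply: inj_forget => //; apply/forgetP => j ji.
have : j \in [set~ i] by rewrite !inE.
by move/kxy; rewrite !inE /= => /andP[_ /eqP].
Qed.

Lemma replace_coordinate (B : {set power_alg A n.+1}) x a :
    almost_minimal_spectrum A -> irreducible_subdirect B -> x \in B ->
  exists y, [/\ y \in B, proj i y = a & forall j, j != i -> proj j y = proj j x].
Proof.
move=> hA irrB xB.
have [[subB _] _] := irrB.
have [m Bm] := hA _ _ subB.
have [k Bk] := hA _ _ (subalgebra_forget subB).
have ltkm : k < m.
  rewrite ltnNge; apply/negP => lemk.
  have := forget_noninjective irrB.
  by rewrite Bk Bm ltnNge leq_pexp2l ?carrier_gt0.
pose g (y : power_alg A n.+1) := (proj i y, forget y).
(* By injectivity of [g], the left side has [#|A| ^ m] elements; the right side has [#|A| ^ k.+1],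
   which is no more since [k < m]. *)
have /eqP gB : g @: B == setX [set: A] (forget @: B).
  rewrite eqEcard; apply/andP; split.
    by apply/subsetP=> _ /imsetP[y yB ->]; rewrite !inE /= imset_f.
  rewrite (card_imset _ proj_forget_inj) cardsX cardsT Bk Bm -expnS.
  by rewrite leq_pexp2l ?carrier_gt0.
have : (a, forget x) \in g @: B by rewrite gB !inE /= imset_f.
by case/imsetP=> y yB [-> /forgetP exy]; exists y; split=> // j /exy.
Qed.

End ForgetCoordinate.

Theorem theorem2p60 (S : signature) (A : finAlgebra S)
  (hA : almost_minimal_spectrum A) :
  direct_factor_set (fun X : finAlgebra S => X = A).
Proof.
(* The type of [B] depends on [F], so the family is replaced as a whole. *)
move=> n F FA; have {FA} -> : F = (fun=> A) by apply: functional_extensionality.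
move=> {F} B irrB; apply/setP=> z; rewrite [RHS]inE.
(* Starting from any element of [B], the coordinates listed in [s] are changed one at a time to
   those of [z]. *)
have agree (s : seq 'I_n) :
    exists2 x, x \in B & forall j, j \in s -> proj j x = proj j z.
  elim: s => [|i s [x xB exz]].
    by have [[[/set0Pn[x xB] _] _] _] := irrB; exists x.
  (* The index [i] forces [n] to be a successor, as [replace_coordinate] requires. *)
  case: n => [|n] in B irrB z i s x xB exz *; first by case: i.
  have [y [yB yi yx]] := replace_coordinate (i := i) (proj i z) hA irrB xB.
  exists y => // j; rewrite inE; have [-> _ //|ji /= js] := eqVneq j i.
  by rewrite yx // exz.
have [x xB exz] := agree (enum 'I_n).
suff -> : z = x by [].
by apply/ffunP=> j; rewrite [LHS](esym (exz j _)) ?mem_enum.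
Qed.
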